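(* Let $G$ be a finite group. If $G$ contains an element of order $p^2q^2$ for some distinct primes $p,q$, then the power graph $\mathrm{Pow}(G)$ is non-chordal. Otherwise, if for each $x\in G$ of prime order $p$ the centralizer $C_G(x)$ is either a $p$-group or of the form $C_{q^n}\rtimes P$, where $q$ is a prime distinct from $p$ and $P$ is a $p$-group, then $\mathrm{Pow}(G)$ is chordal.
   Context: The power graph $\mathrm{Pow}(G)$ of a group $G$ is the simple graph with vertex set $G$ in which two distinct elements $x,y$ are joined by an edge if and only if $x^m=y$ or $y^m=x$ for some $m\in\mathbb{N}$. A graph is chordal if it has no induced cycle on at least four vertices. $C_{q^n}$ denotes a cyclic group of order $q^n$; here $p$ is the order of $x$, and $q$, $n$ and $P$ may depend on $x$. *)

(* Defs.v *)
From mathcomp Require Import all_boot all_fingroup all_solvable.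

Set Implicit Arguments.
Unset Strict Implicit.
Unset Printing Implicit Defensive.

Local Open Scope group_scope.

Record sgraph (T : finType) := SGraph {
  vertices : {set T};
  adj : T -> T -> Prop;
  adj_vertices : forall x y, adj x y -> x \in vertices /\ y \in vertices;
  adj_sym : forall x y, adj x y -> adj y x;
  adj_irrefl : forall x, ~ adj x x
}.

(* The vertices c 0, ..., c (k - 1) are distinct and the only edges between
   them are those joining cyclically consecutive ones. This describes a cycle
   when 3 <= k, the only case used below. *)
Definition induced_cycle (T : finType) (X : sgraph T) (k : nat)
    (c : 'I_k -> T) : Prop :=
  [/\ injective c,
      forall i, c i \in vertices X
    & forall i j : 'I_k, adj X (c i) (c j) <->
        (j = i.+1 %[mod k] \/ i = j.+1 %[mod k])].

Definition chordal (T : finType) (X : sgraph T) : Prop :=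
  forall (k : nat) (c : 'I_k -> T), (4 <= k)%N -> ~ induced_cycle X c.

Section PowerGraph.

Variables (gT : finGroupType) (G : {group gT}).

Definition power_adj (x y : gT) : Prop :=
  [/\ x \in G, y \in G, x <> y
    & (exists m : nat, x ^+ m = y) \/ (exists m : nat, y ^+ m = x)].

Fact power_adj_vertices x y : power_adj x y -> x \in G /\ y \in G.
Proof. by case. Qed.

Fact power_adj_sym x y : power_adj x y -> power_adj y x.
Proof.
by case=> xG yG nxy xy; split=> //; [exact: nesym | case: xy; [right | left]].
Qed.

Fact power_adj_irrefl x : ~ power_adj x x.
Proof. by case. Qed.

Definition Pow : sgraph gT :=
  SGraph power_adj_vertices power_adj_sym power_adj_irrefl.

End PowerGraph.

Definition cyclic_sdprod_pgroup (gT : finGroupType) (p : nat) (H : {set gT})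
    : Prop :=
  exists (q n : nat) (K P : {group gT}),
    (prime q /\ q <> p) /\
    [/\ cyclic K, #|K| = (q ^ n)%N, p.-group P & K ><| P = H].

(* Main.v *)
Require Import Defs.
From mathcomp Require Import all_boot all_fingroup all_solvable.

(** Two elements x and y are adjacent in Pow(G) exactly when they are distinct
    and the cyclic groups <x> and <y> are comparable for inclusion
    ([power_adjP]), so everything takes place in the poset of cyclic subgroups.

    If g has order p^2 q^2, the subgroups of <g> of orders p, p^2 q, q, p q^2
    form an induced 4-cycle: the first and third have order p and q and are
    contained in the other two, and there are no further inclusions
    ([Pow_nonchordal]).

    Conversely, inclusions alternate along an induced cycle of length at least
    4: two successive inclusions in the same direction would, by transitivity,
    make two vertices at distance 2 adjacent. So some stretch of the cycle reads
    f0 < f1 > f2 < f3 > f4. The peaks f1 and f3 contain incomparable subgroups,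
    so neither has prime power order, and the valley f2 is not trivial.
    [cyclic_overgroups_comparable] says that <f1> and <f3> are then comparable,
    which is the contradiction.

    For that lemma, let b and d be the peaks and x an element of prime order p
    of both <b> and <d>. As b lies in C_G(x) and does not have prime power
    order, this centralizer is not a p-group, hence it has a cyclic
    normal q-subgroup K containing all its p'-elements, in particular the
    p'-parts of b and d. These are therefore comparable, and both
    contain the unique subgroup <y> of order q of K. The centralizer of y has in
    the same way a cyclic normal subgroup containing the p-parts of b and d, so
    these are comparable too. If both comparisons go in the same direction, then
    <b> and <d> are comparable. Otherwise, say, the p-part of b is strictly
    larger than that of d and the q-part of d strictly larger than that of b;
    then these larger parts have orders divisible by p^2 and q^2. The p-part of
    b acts coprimely on K and fixes y, hence centralizes K
    ([coprime_cyclic_cent]). So the two larger parts commute, and a power of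
    their product has the excluded order p^2 q^2. *)

Local Open Scope group_scope.

(** * Adjacency and inclusion of cyclic subgroups *)

Lemma power_adjP (gT : finGroupType) (G : {group gT}) (x y : gT) :
  power_adj G x y <->
  [/\ x \in G, y \in G, x <> y
    & <[x]> \subset <[y]> \/ <[y]> \subset <[x]>].
Proof.
have powE u v : (exists m, u ^+ m = v) <-> <[v]> \subset <[u]>.
  rewrite cycle_subG; split=> [[m <-]|/cycleP[m ->]]; first exact: mem_cycle.
  by exists m.
by split=> -[xG yG nxy xy]; split=> //; case: xy => /powE; auto.
Qed.

(** * An induced 4-cycle from an element of order p^2 q^2 *)

Lemma prime_powers_dvd p q a b c d : prime p -> prime q -> p <> q ->
  (p ^ a * q ^ b %| p ^ c * q ^ d)%N = (a <= c)%N && (b <= d)%N.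
Proof.
move=> pr_p pr_q /eqP npq.
have cop i j : coprime (p ^ i) (q ^ j).
  by apply: coprimeXl; apply: coprimeXr; rewrite prime_coprime // dvdn_prime2.
rewrite Gauss_dvd // Gauss_dvdl // Gauss_dvdr; last by rewrite coprime_sym.
by rewrite !dvdn_Pexp2l ?prime_gt1.
Qed.

Lemma cycle_expg_sub (gT : finGroupType) (g : gT) (m n : nat) :
  (n %| #[g])%N -> (<[g ^+ m]> \subset <[g ^+ n]>) = (n %| m)%N.
Proof.
move=> n_dvd; rewrite cycle_subG; apply/cycleP/idP => [[i]|/dvdnP[i ->]].
  rewrite -expgM => /eqP; rewrite eq_expg_mod_order => /eqP eq_mod.
  by rewrite /dvdn -(modn_dvdm m n_dvd) eq_mod modn_dvdm // modnMr.
by exists i; rewrite -expgM mulnC.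
Qed.

(** The exponents (s, t) of the four vertices g ^+ (p ^ s * q ^ t) turn
    inclusion of subgroups into the reversed product order on pairs, where all
    comparisons are decided by computation. *)
Lemma Pow_nonchordal (gT : finGroupType) (G : {group gT}) (p q : nat)
    (g : gT) :
    prime p -> prime q -> p <> q -> g \in G -> #[g] = (p ^ 2 * q ^ 2)%N ->
  ~ chordal (Pow G).
Proof.
move=> pr_p pr_q npq gG og.
(* The vertices have orders p, p^2 q, q and p q^2, in this order. *)
pose s := nth 0%N [:: 1; 0; 2; 1]%N; pose t := nth 0%N [:: 2; 1; 1; 0]%N.
pose c (i : 'I_4) := g ^+ (p ^ s i * q ^ t i).
have c_sub (i j : 'I_4) :
    (<[c i]> \subset <[c j]>) = (s j <= s i)%N && (t j <= t i)%N.
  rewrite cycle_expg_sub ?prime_powers_dvd // og prime_powers_dvd //.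
  by case: j => [[|[|[|[|]]]]].
have inj_c : injective c.
  move=> i j eq_c.
  have: (<[c i]> \subset <[c j]>) && (<[c j]> \subset <[c i]>).
    by rewrite eq_c subxx.
  rewrite !c_sub => st; apply/val_inj; move: st.
  by case: i {eq_c} => [[|[|[|[|]]]] ?] //; case: j => [[|[|[|[|]]]] ?].
move/(_ 4 c isT); apply; split=> [|i|i j]; [exact: inj_c | exact: groupX |].
have cyc_c : (j = i.+1 %[mod 4] \/ i = j.+1 %[mod 4]) <->
    (i != j) && ((<[c i]> \subset <[c j]>) || (<[c j]> \subset <[c i]>)).
  rewrite !c_sub; case: i => [[|[|[|[|]]]] ?] //;
    case: j => [[|[|[|[|]]]] ?] //=; by split=> [[] | ] //; auto.
apply: (iff_trans (power_adjP _ _ _ _)); apply: (iff_trans _ (iff_sym cyc_c)).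
split=> [[_ _ nij /orP ->] | /andP[nij /orP cmp]].
  by rewrite andbT; apply/eqP => eij; rewrite eij in nij.
by split=> //; try exact: groupX; move/inj_c/eqP; apply/negP.
Qed.

(** * Cyclic groups of prime power order and coprime action *)

Lemma cyclic_pgroup_comparable (gT : finGroupType) (p : nat)
    (K A B : {group gT}) :
    cyclic K -> p.-group K -> A \subset K -> B \subset K ->
  A \subset B \/ B \subset A.
Proof.
move=> cycK pK sAK sBK.
rewrite -(cardSg_cyclic cycK sAK sBK) -(cardSg_cyclic cycK sBK sAK).
have [i ->] := p_natP (pgroupS sAK pK); have [j ->] := p_natP (pgroupS sBK pK).
by case/orP: (leq_total i j) => le; [left | right]; apply: dvdn_exp2l.
Qed.

Lemma dvdn_sq_pgroup_proper (gT : finGroupType) (p : nat)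
    (A B : {group gT}) :
  prime p -> p.-group B -> (p %| #|A|)%N -> A \proper B -> (p ^ 2 %| #|B|)%N.
Proof.
move=> pr_p pB p_dvd_A prAB.
have := proper_card prAB; have pA := pgroupS (proper_sub prAB) pB.
move: p_dvd_A.
have [i ->] := p_natP pA; have [j ->] := p_natP pB.
rewrite ltn_exp2l ?prime_gt1 // => p_dvd ltij.
apply: dvdn_exp2l; case: i p_dvd ltij {pA} => [|i _]; last exact: leq_ltn_trans.
by rewrite dvdn1 => /eqP p1; rewrite p1 in pr_p.
Qed.

(** By coprime action the abelian group K is the direct product of [K, A] and
    C_K(A). If [K, A] were nontrivial it would contain the unique subgroup <y>
    of order q of K, which A centralizes, against C_[K, A](A) = 1. *)
Lemma coprime_cyclic_cent (gT : finGroupType) (q : nat)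
    (K A : {group gT}) (y : gT) :
    cyclic K -> q.-group K -> A \subset 'N(K) -> coprime #|K| #|A| ->
    y \in K -> #[y] = q -> A \subset 'C[y] ->
  K \subset 'C(A).
Proof.
move=> cycK qK nKA coKA yK oy cAy.
have sRK : [~: K, A] \subset K by rewrite commg_subl.
have TI := coprime_abel_cent_TI nKA coKA (cyclic_abelian cycK).
apply/commG1P/eqP; apply: contraT => ntR.
have [pr_q q_dvd _] := pgroup_pdiv (pgroupS sRK qK) ntR.
have syR : <[y]> \subset [~: K, A].
  by rewrite -(cardSg_cyclic cycK) ?cycle_subG // [#|<[y]>|]oy.
have : y \in 'C_[~: K, A](A).
  by rewrite inE -cycle_subG syR -sub_cent1.
by rewrite TI => /set1P y1; rewrite -oy y1 order1 in pr_q.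
Qed.

Lemma exists_order_of_dvdn (gT : finGroupType) (G : {group gT}) (z : gT)
    (n : nat) :
  z \in G -> (n %| #[z])%N -> exists2 g, g \in G & #[g] = n.
Proof.
move=> zG n_dvd; exists (z ^+ (#[z] %/ n)); first exact: groupX.
by rewrite orderXdiv ?dvdn_div // divnA // mulKn.
Qed.

(** * The comparison of cyclic overgroups *)

(** In the semidirect product the kernel is a normal Hall p'-subgroup, so it
    absorbs every p'-element; the element b rules out the case of a p-group. *)
Lemma cyclic_normal_pcompl (gT : finGroupType) (p : nat) (C : {group gT})
    (b : gT) :
    prime p -> p.-group C \/ cyclic_sdprod_pgroup p C ->
    b \in C -> ~ p.-elt b ->
  exists (q : nat) (K : {group gT}),
    [/\ prime q, q <> p, cyclic K, q.-group K & K <| C]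
    /\ forall z, z \in C -> p^'.-elt z -> z \in K.
Proof.
move=> pr_p [pC | [q [n [K [P [[pr_q nqp] [cycK oK pP defC]]]]]]] bC npb.
  by case: npb; apply: mem_p_elt pC bC.
have [nsKC _ _ _ _] := sdprod_context defC.
have qK : q.-group K by rewrite /pgroup oK pnatX pnat_id.
exists q, K; split=> // z zC p'z.
rewrite (mem_normal_Hall (pi := p^') _ nsKC zC) //.
rewrite /pHall normal_sub //=; apply/andP; split.
  by apply: sub_pgroup qK => r; rewrite !inE => /eqP->; apply/eqP.
rewrite -divgS ?normal_sub // -(sdprod_card defC) mulKn //.
by rewrite pnatNK.
Qed.

(** Two cyclic subgroups that meet nontrivially and do not have prime power
    order split into a p-part and a q-part for the same p and q. The p-parts lie
    in one cyclic p-group and the q-parts in one cyclic q-group, so only strict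
    inclusions in opposite directions could make the two subgroups incomparable,
    and these yield an element of order p^2 q^2. *)
Lemma cyclic_overgroups_comparable (gT : finGroupType) (G : {group gT})
    (a b d : gT) :
    ~ (exists (p q : nat) (g : gT),
      [/\ prime p, prime q, p <> q, g \in G & #[g] = (p ^ 2 * q ^ 2)%N]) ->
    (forall (p : nat) (x : gT), x \in G -> prime p -> #[x] = p ->
      p.-group 'C_G[x] \/ cyclic_sdprod_pgroup p 'C_G[x]) ->
    b \in G -> d \in G -> a != 1 -> a \in <[b]> -> a \in <[d]> ->
    (forall p, prime p -> ~ p.-elt b) -> (forall p, prime p -> ~ p.-elt d) ->
  <[b]> \subset <[d]> \/ <[d]> \subset <[b]>.
Proof.
move=> noG centG bG dG nta ab ad nb nd.
have cyc_cent z u : u \in G -> z \in <[u]> -> u \in 'C_G[z].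
  by move=> uG /cycleP[i ->]; rewrite inE uG; apply/cent1P/commuteX.
have pr_p : prime (pdiv #[a]) by rewrite pdiv_prime ?order_gt1.
move: (pdiv _) pr_p (pdiv_dvd #[a]) => p pr_p p_dvd.
have [x xa ox] := Cauchy pr_p p_dvd.
have xb : x \in <[b]> by move: x xa {ox}; apply/subsetP; rewrite cycle_subG.
have xd : x \in <[d]> by move: x xa {ox xb}; apply/subsetP; rewrite cycle_subG.
have sbG : <[b]> \subset G by rewrite cycle_subG.
have xG : x \in G := subsetP sbG x xb.
have bCx := cyc_cent x b bG xb; have dCx := cyc_cent x d dG xd.
have [q [K [[pr_q nqp cycK qK nsK] memK]]] :=
  cyclic_normal_pcompl _ _ 'C_G[x]%G b pr_p (centG p x xG pr_p ox) bCx
    (nb p pr_p).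
have partK u : u \in 'C_G[x] -> u.`_p^' \in K.
  by move=> uC; apply: memK; rewrite ?p_elt_constt ?groupX.
have bK := partK b bCx; have dK := partK d dCx.
have nt_part (u : gT) : ~ p.-elt u -> u.`_p^' != 1.
  by move=> npu; apply/eqP => /constt1P; rewrite /p_elt pnatNK.
(* A nontrivial p'-part in K contains the unique subgroup of order q of K. *)
have ntK : K :!=: 1.
  by apply: subG1_contra (_ : <[b.`_p^']> != 1); rewrite ?cycle_subG ?cycle_eq1
    ?nt_part //; apply: nb.
have [_ q_dvd _] := pgroup_pdiv qK ntK.
have [y yK oy] := Cauchy pr_q q_dvd.
have y_part u : u.`_p^' \in K -> ~ p.-elt u -> y \in <[u.`_p^']>.
  move=> uK npu; have sK : <[u.`_p^']> \subset K by rewrite cycle_subG.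
  have [|_ q_dvd_u _] := pgroup_pdiv (pgroupS sK qK).
    by rewrite cycle_eq1 nt_part.
  by rewrite -cycle_subG -(cardSg_cyclic cycK) ?cycle_subG // [#|<[y]>|]oy.
have part_cyc pi (u : gT) : <[u.`_pi]> \subset <[u]>.
  by rewrite cycle_subG cycle_constt.
have yb := subsetP (part_cyc _ _) _ (y_part b bK (nb p pr_p)).
have yd := subsetP (part_cyc _ _) _ (y_part d dK (nd p pr_p)).
have yG : y \in G := subsetP sbG y yb.
have bCy := cyc_cent y b bG yb; have dCy := cyc_cent y d dG yd.
(* The same argument around y, with p and q exchanged, controls the p-parts. *)
have [r [L [[_ _ cycL rL _] memL]]] :=
  cyclic_normal_pcompl _ _ 'C_G[y]%G b pr_q (centG q y yG pr_q oy) bCy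
    (nb q pr_q).
have q'p (u : gT) : p.-elt u -> q^'.-elt u.
  by apply: sub_p_elt => l; rewrite !inE => /eqP->; apply/eqP/nesym.
have ppartL u : u \in 'C_G[y] -> <[u.`_p]> \subset L.
  by move=> uC; rewrite cycle_subG memL ?q'p ?p_elt_constt ?groupX.
have ppartK u : u \in 'C_G[x] -> <[u.`_p^']> \subset K.
  by move=> uC; rewrite cycle_subG partK.
have x_part u : x \in <[u]> -> x \in <[u.`_p]>.
  move=> /cycleP[i xE]; have: p.-elt x by rewrite /p_elt ox pnat_id.
  move/constt_p_elt <-; rewrite {1}xE consttX.
  exact: mem_cycle.
have glue (u v : gT) :
    <[u.`_p]> \subset <[v.`_p]> -> <[u.`_p^']> \subset <[v.`_p^']> ->
    <[u]> \subset <[v]>.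
  rewrite !cycle_subG => pu qu; rewrite -(consttC p u).
  by rewrite groupM ?(subsetP (part_cyc p v) _ pu)
    ?(subsetP (part_cyc _ v) _ qu).
(* Strict inclusions in opposite directions: the p-part of u and the q-part of
   v commute because the former fixes y and hence centralizes K. *)
have cross u v : u \in 'C_G[x] -> v \in 'C_G[x] ->
    u \in 'C[y] -> x \in <[v]> -> y \in <[u.`_p^']> ->
    <[v.`_p]> \proper <[u.`_p]> -> <[u.`_p^']> \proper <[v.`_p^']> -> False.
  move=> uCx vCx uCy xv yu prp prq; apply: noG.
  have up : u.`_p \in 'C_G[x] := groupX _ uCx.
  have cKu : K \subset 'C(<[u.`_p]>).
    apply: (@coprime_cyclic_cent _ q K _ y) => //.
    - by rewrite cycle_subG (subsetP (normal_norm nsK)).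
    - apply: pnat_coprime qK _.
      exact/q'p/p_elt_constt.
    - by rewrite cycle_subG groupX.
  have vK := partK v vCx.
  have com : commute u.`_p v.`_p^'.
    by apply/commute_sym; apply: (centsP cKu); rewrite ?cycle_id.
  have co : coprime #[u.`_p] #[v.`_p^'].
    by apply: pnat_coprime (p_elt_constt _ _) (p_elt_constt _ _).
  have [||g gG og] :=
    @exists_order_of_dvdn _ G (u.`_p * v.`_p^') (p ^ 2 * q ^ 2).
  - by apply: groupM; apply: groupX; [case/setIP: uCx | case/setIP: vCx].
  - rewrite orderM //; apply: dvdn_mul.
      apply: (@dvdn_sq_pgroup_proper _ p _ _ pr_p _ _ prp).
        exact: p_elt_constt.
      by rewrite -{1}ox order_dvdG // x_part.
    apply: (@dvdn_sq_pgroup_proper _ q _ _ pr_q _ _ prq).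
      by apply: pgroupS qK; rewrite cycle_subG.
    by rewrite -{1}oy order_dvdG.
  by exists p, q, g; split=> //; apply/nesym.
have properI (A B : {group gT}) :
    A \subset B -> ~~ (B \subset A) -> A \proper B.
  by rewrite properE => ->.
have [[_ bCy'] [_ dCy']] := (setIP bCy, setIP dCy).
have [yb' yd'] := (y_part b bK (nb p pr_p), y_part d dK (nd p pr_p)).
case sbd: (<[b]> \subset <[d]>); [by left | right].
case: (cyclic_pgroup_comparable _ r L _ _ cycL rL (ppartL b bCy) (ppartL d dCy))
  => p_le;
case: (cyclic_pgroup_comparable _ q K _ _ cycK qK (ppartK b bCx) (ppartK d dCx))
  => q_le.
- by rewrite glue in sbd.
- case p_ge: (<[d.`_p]> \subset <[b.`_p]>); first exact: glue.
  case q_ge: (<[b.`_p^']> \subset <[d.`_p^']>); first by rewrite glue in sbd.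
  by case: (cross d b); rewrite ?properI ?p_ge ?q_ge.
- case p_ge: (<[b.`_p]> \subset <[d.`_p]>); first by rewrite glue in sbd.
  case q_ge: (<[d.`_p^']> \subset <[b.`_p^']>); first exact: glue.
  by case: (cross b d); rewrite ?properI ?p_ge ?q_ge.
- exact: glue.
Qed.

(** * Alternation along an induced cycle *)

Lemma incomparable_not_pelt (gT : finGroupType) (p : nat) (u v w : gT) :
    <[u]> \subset <[w]> -> <[v]> \subset <[w]> ->
    ~ (<[u]> \subset <[v]> \/ <[v]> \subset <[u]>) ->
  ~ p.-elt w.
Proof.
move=> suw svw nuv pw; apply: nuv.
exact: (cyclic_pgroup_comparable _ p _ _ _ (cycle_cyclic w) pw).
Qed.

(** Unrolling the cycle to a sequence indexed by nat removes modular arithmetic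
    from the rest of the argument. The bound 4 <= k makes vertices two steps
    apart distinct and not joined, hence incomparable as cyclic subgroups. *)
Lemma induced_cycle_walk (gT : finGroupType) (G : {group gT}) (k : nat)
    (c : 'I_k -> gT) :
    (4 <= k)%N -> induced_cycle (Pow G) c ->
  exists f : nat -> gT, forall n,
    [/\ f n \in G,
        <[f n]> \subset <[f n.+1]> \/ <[f n.+1]> \subset <[f n]>
      & ~ (<[f n]> \subset <[f n.+2]> \/ <[f n.+2]> \subset <[f n]>)].
Proof.
move=> k4 [inj_c cG adj_c]; have k0 : (0 < k)%N by apply: leq_trans k4.
pose o n := Ordinal (ltn_pmod n k0).
have succ_mod m : (m %% k).+1 %% k = m.+1 %% k
  by rewrite -addn1 modnDml addn1.
have far i : (0 < i < 4)%N -> forall m, (m == m + i %[mod k]) = false.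
  case/andP=> i0 i4 m; rewrite -{1}[m]addn0 eqn_modDl mod0n modn_small.
    by case: i i0 {i4}.
  exact: leq_trans k4.
exists (fun n => c (o n)) => n; split; first exact: cG.
  have : adj (Pow G) (c (o n)) (c (o n.+1)).
    by apply/adj_c; left; rewrite /= modn_mod succ_mod.
  by case/power_adjP.
move=> cmp; have : adj (Pow G) (c (o n)) (c (o n.+2)).
  apply/power_adjP; split=> //; try exact: cG.
  by move/inj_c => /(congr1 val)/= /eqP; rewrite -addn2 far.
case/adj_c => /= /eqP; rewrite modn_mod succ_mod.
  by rewrite eq_sym -(addn1 n.+1) far.
by rewrite -addn3 far.
Qed.

(** Vertices two steps apart are incomparable, so the inclusions alternate, and
    two consecutive peaks share the valley between them; a peak cannot have
    prime power order since it contains two incomparable subgroups. The outer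
    valleys may coincide, so cycles of length 4 need no separate treatment. *)
Lemma Pow_chordal (gT : finGroupType) (G : {group gT}) :
    ~ (exists (p q : nat) (g : gT),
      [/\ prime p, prime q, p <> q, g \in G & #[g] = (p ^ 2 * q ^ 2)%N]) ->
    (forall (p : nat) (x : gT), x \in G -> prime p -> #[x] = p ->
      p.-group 'C_G[x] \/ cyclic_sdprod_pgroup p 'C_G[x]) ->
  chordal (Pow G).
Proof.
move=> noG centG k c k4 /(induced_cycle_walk _ _ _ _ k4)[f fP].
have fG n : f n \in G by case: (fP n).
have cmp n : <[f n]> \subset <[f n.+1]> \/ <[f n.+1]> \subset <[f n]>.
  by case: (fP n).
have inc n : ~ (<[f n]> \subset <[f n.+2]> \/ <[f n.+2]> \subset <[f n]>).
  by case: (fP n).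
have up_down n : <[f n]> \subset <[f n.+1]> -> <[f n.+2]> \subset <[f n.+1]>.
  move=> up; case: (cmp n.+1) => // up'; case: (inc n); left.
  exact: subset_trans up up'.
have down_up n : <[f n.+1]> \subset <[f n]> -> <[f n.+1]> \subset <[f n.+2]>.
  move=> dn; case: (cmp n.+1) => // dn'; case: (inc n); right.
  exact: subset_trans dn' dn.
have [n up0] : exists n, <[f n]> \subset <[f n.+1]>.
  by case: (cmp 0%N) => [|/down_up]; [exists 0%N | exists 1%N].
have dn1 := up_down _ up0; have up2 := down_up _ dn1; have dn3 := up_down _ up2.
apply: (inc n.+1); apply: (cyclic_overgroups_comparable _ G (f n.+2)) => //.
- apply/eqP => f1; case: (inc n); right; rewrite f1 cycle1; exact: sub1G.
- by rewrite -cycle_subG.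
- by rewrite -cycle_subG.
- by move=> p _; apply: incomparable_not_pelt up0 dn1 (inc n).
- by move=> p _; apply: incomparable_not_pelt up2 dn3 (inc n.+2).
Qed.

Theorem lemma3p14 (gT : finGroupType) (G : {group gT}) :
  ((exists (p q : nat) (g : gT),
      [/\ prime p, prime q, p <> q, g \in G & #[g] = (p ^ 2 * q ^ 2)%N]) ->
   ~ chordal (Pow G))
  /\
  (~ (exists (p q : nat) (g : gT),
      [/\ prime p, prime q, p <> q, g \in G & #[g] = (p ^ 2 * q ^ 2)%N]) ->
   (forall (p : nat) (x : gT), x \in G -> prime p -> #[x] = p ->
      p.-group 'C_G[x] \/ cyclic_sdprod_pgroup p 'C_G[x]) ->
   chordal (Pow G)).
Proof.
split=> [[p [q [g [pr_p pr_q npq gG og]]]] | noG centG].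
  exact: Pow_nonchordal pr_p pr_q npq gG og.
exact: Pow_chordal.
Qed.
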